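(* Let $N\ge2$, $n\ge 5$, and let $F_1,F_2\subseteq \mathrm{BS}(1,N)$ be finite subsets such that $$\left(F_1\cdot\{e,a,a^{-1},b,b^{-1}\}\right)\cap F_2=\varnothing,$$ where $e$ is the identity of $\mathrm{BS}(1,N)$. Then for every choice of locally admissible patterns $p_i\in\{0,\ldots,n-1\}^{F_i}$, $i=1,2$, there exists $x\in\mathcal{C}_n$ such that $x|_{F_1}=p_1$ and $x|_{F_2}=p_2$. Consequently, for $n\ge5$ the graph-coloring subshift $\mathcal{C}_n$ is strongly irreducible.
   Context: $\mathrm{BS}(1,N)=\langle a,b\mid bab^{-1}=a^N\rangle$. For $n\ge2$, the graph-coloring subshift is $$\mathcal{C}_n=\{x\in\{0,\ldots,n-1\}^{\mathrm{BS}(1,N)} : x_g\ne x_{gs}\text{ for all } g\in \mathrm{BS}(1,N),\ s\in\{a,b\}\}.$$ A pattern is an element $p\in\{0,\ldots,n-1\}^F$ with $F\subseteq\mathrm{BS}(1,N)$ finite; $\mathrm{supp}(p)=F$. It is locally admissible (for $\mathcal{C}_n$) if $p(g)\neq p(gs)$ whenever $s\in\{a,b\}$ and $g,gs\in F$ (i.e. it contains no forbidden pattern), and globally admissible if $p=x|_F$ for some $x\in\mathcal{C}_n$. For a pattern $p$, $[p]$ denotes the set of configurations in the subshift which restrict to $p$ on $\mathrm{supp}(p)$. A subshift $X\subseteq\mathcal{A}^{\Lambda}$ over a group $\Lambda$ is strongly irreducible if there is a finite $F\subseteq\Lambda$ such that for all globally admissible patterns $p,q$ in $X$ with $\mathrm{supp}(p)\cap(\mathrm{supp}(q)\cdot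 F)=\varnothing$, there is a configuration of $X$ in $[p]\cap[q]$, i.e. $[p]\cap[q]\neq\varnothing$. *)

(* Defs.v *)
From HB Require Import structures.
From mathcomp Require Import all_boot.
From mathcomp Require Import generic_quotient finmap.
From mathcomp Require Import boolp classical_sets.

Set Implicit Arguments.
Unset Strict Implicit.
Unset Printing Implicit Defensive.

Local Open Scope classical_set_scope.
Local Open Scope fset_scope.
Local Open Scope fmap_scope.
Local Open Scope quotient_scope.
Local Open Scope group_scope.

(* Groups given by a presentation < T | R >.  A letter (x, false) stands for
   the generator x and (x, true) for its inverse; R l r means that l = r is
   one of the defining relations. *)

Section Presentation.

Variable T : choiceType.

Definition word := seq (T * bool).

Definition word_inv (w : word) : word :=
  rev [seq (l.1, ~~ l.2) | l <- w].

Inductive word_eq (R : word -> word -> Prop) : word -> word -> Prop :=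
| WordRel u v : R u v -> word_eq R u v
| WordCancel x e : word_eq R [:: (x, e); (x, ~~ e)] [::]
| WordCat u u' v v' :
    word_eq R u u' -> word_eq R v v' -> word_eq R (u ++ v) (u' ++ v')
| WordRefl u : word_eq R u u
| WordSym u v : word_eq R u v -> word_eq R v u
| WordTrans v u w : word_eq R u v -> word_eq R v w -> word_eq R u w.

Variable R : word -> word -> Prop.

Definition word_eqb : rel word := fun u v => `[< word_eq R u v >].

Lemma word_eqb_refl : reflexive word_eqb.
Proof. by move=> u; apply/asboolP; apply: WordRefl. Qed.

Lemma word_eqb_sym : symmetric word_eqb.
Proof. by move=> u v; apply/asboolP/asboolP => /WordSym. Qed.

Lemma word_eqb_trans : transitive word_eqb.
Proof.
by move=> v u w /asboolP uv /asboolP vw; apply/asboolP; apply: WordTrans vw.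
Qed.

Canonical word_equiv := EquivRel word_eqb word_eqb_refl word_eqb_sym
  word_eqb_trans.

Definition presented := {eq_quot word_equiv}.

HB.instance Definition _ := Choice.on presented.
HB.instance Definition _ := Quotient.on presented.

Definition pres_class (w : word) : presented := \pi_presented%qT w.

Lemma pres_classP u v : pres_class u = pres_class v <-> word_eq R u v.
Proof.
split=> [/eqquotP|uv]; first by move/asboolP.
by apply/eqquotP/asboolP.
Qed.

Lemma pres_classK (x : presented) : pres_class (repr x) = x.
Proof. exact: reprK. Qed.

Lemma word_invK : involutive word_inv.
Proof.
move=> w; rewrite /word_inv map_rev revK -map_comp.
by rewrite (@eq_map _ _ _ id) ?map_id // => -[x e] /=; rewrite negbK.
Qed.

Lemma word_eq_invl w : word_eq R (word_inv w ++ w) [::].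
Proof.
elim: w => [|[x e] w IHw]; first exact: WordRefl.
rewrite /word_inv /= rev_cons cat_rcons -/(word_inv w).
apply: WordTrans IHw; apply: WordCat (WordRefl _ _) _.
rewrite -[w in word_eq _ _ w]cat0s.
rewrite -[_ :: _]/([:: (x, ~~ e); (x, e)] ++ w).
apply: WordCat (WordRefl _ _).
by have := WordCancel R x (~~ e); rewrite negbK.
Qed.

Lemma word_eq_invr w : word_eq R (w ++ word_inv w) [::].
Proof. by have := word_eq_invl (word_inv w); rewrite word_invK. Qed.

Lemma word_eq_inv u v : word_eq R u v -> word_eq R (word_inv u) (word_inv v).
Proof.
move=> uv; apply: (@WordTrans R (word_inv u ++ (v ++ word_inv v))).
  rewrite -[X in word_eq _ X _]cats0.
  exact: WordCat (WordRefl _ _) (WordSym (word_eq_invr v)).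
rewrite catA -[X in word_eq _ _ X]cat0s.
apply: WordCat (WordRefl _ _).
exact: WordTrans (WordCat (WordRefl _ _) (WordSym uv)) (word_eq_invl u).
Qed.

Definition pres_one : presented := pres_class [::].
Definition pres_mul (x y : presented) : presented :=
  pres_class (repr x ++ repr y).
Definition pres_inv (x : presented) : presented :=
  pres_class (word_inv (repr x)).

Lemma pres_mulE u v : pres_mul (pres_class u) (pres_class v)
  = pres_class (u ++ v).
Proof.
by apply/pres_classP; apply: WordCat; apply/pres_classP; rewrite pres_classK.
Qed.

Lemma pres_invE u : pres_inv (pres_class u) = pres_class (word_inv u).
Proof.
by apply/pres_classP; apply: word_eq_inv; apply/pres_classP; rewrite pres_classK.
Qed.

Lemma pres_mulA : associative pres_mul.
Proof.
move=> x y z; rewrite -(pres_classK x) -(pres_classK y) -(pres_classK z).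
by rewrite !pres_mulE catA.
Qed.

Lemma pres_mul1g : left_id pres_one pres_mul.
Proof. by move=> x; rewrite -(pres_classK x) pres_mulE. Qed.

Lemma pres_mulg1 : right_id pres_one pres_mul.
Proof. by move=> x; rewrite -(pres_classK x) pres_mulE cats0. Qed.

Lemma pres_mulVg : left_inverse pres_one pres_inv pres_mul.
Proof.
move=> x; rewrite -(pres_classK x) pres_invE pres_mulE.
exact/pres_classP/word_eq_invl.
Qed.

Lemma pres_mulgV : right_inverse pres_one pres_inv pres_mul.
Proof.
move=> x; rewrite -(pres_classK x) pres_invE pres_mulE.
exact/pres_classP/word_eq_invr.
Qed.

HB.instance Definition _ := isGroup.Build presented
  pres_mulA pres_mul1g pres_mulg1 pres_mulVg pres_mulgV.

Definition pres_gen (x : T) : presented := pres_class [:: (x, false)].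

End Presentation.

Inductive BSgen := BSgen_a | BSgen_b.

Definition bool_of_BSgen (s : BSgen) := if s is BSgen_a then true else false.
Definition BSgen_of_bool (e : bool) := if e then BSgen_a else BSgen_b.
Lemma bool_of_BSgenK : cancel bool_of_BSgen BSgen_of_bool.
Proof. by case. Qed.
HB.instance Definition _ := Countable.copy BSgen (can_type bool_of_BSgenK).

Inductive BSrel (N : nat) : word BSgen -> word BSgen -> Prop :=
  BSrel_intro : BSrel N
    [:: (BSgen_b, false); (BSgen_a, false); (BSgen_b, true)]
    (nseq N (BSgen_a, false)).
Arguments BSrel N : clear implicits.

Definition BS (N : nat) : groupType := presented (BSrel N).

Definition BSa (N : nat) : BS N := pres_gen (BSrel N) BSgen_a.
Definition BSb (N : nat) : BS N := pres_gen (BSrel N) BSgen_b.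

Lemma BS_relation N : BSb N * BSa N * (BSb N)^-1 = BSa N ^+ N.
Proof.
have aX k : BSa N ^+ k = pres_class (BSrel N) (nseq k (BSgen_a, false)).
  by elim: k => [//|k IHk]; rewrite expgS IHk; apply: pres_mulE.
rewrite aX -[X in _ * X](esym (pres_invE _ _)) -[X in X * _](esym (pres_mulE _ _ _)).
rewrite -[LHS](esym (pres_mulE _ _ _)).
by apply/pres_classP; apply: WordRel.
Qed.

(* A pattern over the group G with alphabet A is a finite map p; its support
   is domf p. *)

Section Patterns.

Variables (G : groupType) (A : Type).

Definition fset_mul (E F : {fset G}) : {fset G} := [fset g * h | g in E, h in F].

Definition restricts_to (x : G -> A) (p : {fmap G -> A}) : Prop :=
  forall g, g \in domf p -> p.[? g] = Some (x g).

Definition cylinder (X : set (G -> A)) (p : {fmap G -> A}) : set (G -> A) :=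
  [set x | X x /\ restricts_to x p].

Definition globally_admissible (X : set (G -> A)) (p : {fmap G -> A}) : Prop :=
  exists x, X x /\ restricts_to x p.

Definition strongly_irreducible (X : set (G -> A)) : Prop :=
  exists F : {fset G}, forall p q : {fmap G -> A},
    globally_admissible X p -> globally_admissible X q ->
    domf p `&` fset_mul (domf q) F = fset0 ->
    (cylinder X p `&` cylinder X q)%classic !=set0.

End Patterns.

Definition coloring_shift (N n : nat) : set (BS N -> 'I_n) :=
  [set x | forall g s, s \in [fset BSa N; BSb N] -> x g <> x (g * s)].
Arguments coloring_shift N n : clear implicits.

Definition locally_admissible (N n : nat) (p : {fmap BS N -> 'I_n}) : Prop :=
  forall g s, s \in [fset BSa N; BSb N] ->
    g \in domf p -> g * s \in domf p -> p.[? g] <> p.[? g * s].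

Definition BSball1 (N : nat) : {fset BS N} :=
  [fset 1; BSa N; (BSa N)^-1; BSb N; (BSb N)^-1].

(* Main.v *)
Require Import Defs.
From mathcomp Require Import all_boot finmap.
From mathcomp Require Import all_order all_algebra.

(** Every vertex of the Cayley graph of BS(1,N) for the generators a and b has
    at most four neighbours, so five colours suffice for greedy colouring: any
    proper partial colouring extends to a proper colouring of the whole group
    by treating the remaining elements one after the other
    ([greedy_extension]).  The hypothesis on the supports says that no edge
    joins F1 to F2, so that the union of the two patterns is such a partial
    colouring.

    The group itself enters only in two places.  It is countable, which orders
    the vertices to be coloured.  Also, the Cayley graph has no loop, that is,
    a and b are nontrivial, without which there would be no proper colouring at
    all; this is seen in the action on the rational line where a translates by
    1 and b scales by N ([BSa_neq1], [BSb_neq1]).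

    Strong irreducibility follows with the ball of radius one as the finite
    set, because globally admissible patterns are locally admissible. *)

Local Open Scope fset_scope.

(** * Greedy colouring of countable graphs *)

Section Greedy.

Variables (T : eqType) (C : finType) (rank : T -> nat) (nbr : T -> seq T).
Hypothesis rank_inj : injective rank.
Hypothesis nbr_sym : forall g h, h \in nbr g -> g \in nbr h.
Hypothesis nbr_irr : forall g, g \notin nbr g.
Hypothesis nbr_small : forall g, size (nbr g) < #|C|.

Definition proper_partial (q : T -> option C) : Prop :=
  forall g h c, h \in nbr g -> q g = Some c -> q h <> Some c.

Lemma exists_unused (s : seq C) : size s < #|C| -> exists c, c \notin s.
Proof.
move=> s_small; apply/existsP; apply: contraTT s_small.
rewrite negb_exists -leqNgt => /forallP s_full.
apply: leq_trans (card_size s); apply: subset_leq_card.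
by apply/subsetP => c _; have := s_full c; rewrite negbK.
Qed.

Definition greedy_step (k : nat) (q : T -> option C) (g : T) : option C :=
  if q g is Some c then Some c else
  if rank g == k then [pick c | c \notin pmap q (nbr g)] else None.

Lemma greedy_step_extends k q g c :
  q g = Some c -> greedy_step k q g = Some c.
Proof. by rewrite /greedy_step => ->. Qed.

(** A step colours a single vertex, by injectivity of the rank; hence of two
    adjacent vertices at most one is new, and its colour avoids that of the
    other. *)
Lemma greedy_step_proper k q :
  proper_partial q -> proper_partial (greedy_step k q).
Proof.
move=> q_proper.
have new g h c : h \in nbr g -> q g = None -> greedy_step k q g = Some c ->
    q h <> Some c.
  rewrite /greedy_step => gh ->; case: ifP => // _; case: pickP => // d d_free.
  case=> <- qh; case/negP: d_free; rewrite mem_pmap.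
  by apply/mapP; exists h.
move=> g h c gh; case qg: (q g) => [d|]; last first.
  move=> sg; have := new g h c gh qg sg; move: sg; rewrite /greedy_step qg.
  case: eqP => // rg _ qh_neq; case: (q h) qh_neq => // _.
  case: eqP => // rh _; case/negP: (nbr_irr g).
  by move: gh; rewrite -(@rank_inj g h) ?rg ?rh.
rewrite (greedy_step_extends _ _ _ _ qg) => -[dc]; rewrite {}dc in qg.
case qh: (q h) => [e|].
  rewrite (greedy_step_extends _ _ _ _ qh) -qh; exact: q_proper gh qg.
by move=> /(new h g c (nbr_sym _ _ gh) qh).
Qed.

Fixpoint greedy_stage (p : T -> option C) (k : nat) : T -> option C :=
  if k is k'.+1 then greedy_step k' (greedy_stage p k') else p.

Lemma greedy_stage_proper p k :
  proper_partial p -> proper_partial (greedy_stage p k).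
Proof. by move=> p_proper; elim: k => //= k; apply: greedy_step_proper. Qed.

Lemma greedy_stage_le p j k g c :
  j <= k -> greedy_stage p j g = Some c -> greedy_stage p k g = Some c.
Proof.
move=> /subnK <-; elim: (k - j) => //= m IHm /IHm; exact: greedy_step_extends.
Qed.

Lemma greedy_stage_rank p g : exists c, greedy_stage p (rank g).+1 g = Some c.
Proof.
rewrite /= /greedy_step; case: (greedy_stage _ _ g) => [c|]; first by exists c.
rewrite eqxx; case: pickP => [c _|full]; first by exists c.
have [|c] := exists_unused (pmap (greedy_stage p (rank g)) (nbr g)).
  by apply: leq_ltn_trans (nbr_small g); rewrite size_pmap count_size.
by rewrite full.
Qed.

(** The stages of the greedy procedure agree wherever they are defined, and
    stage [k] colours all vertices of rank below [k]; their limit is the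
    colouring sought. *)
Lemma greedy_extension (p : T -> option C) : proper_partial p ->
  exists x : T -> C, (forall g h, h \in nbr g -> x g <> x h) /\
    (forall g c, p g = Some c -> x g = c).
Proof.
move=> p_proper.
have c0 (g : T) : C by case: (pickP C) (nbr_small g) => // /eq_card0 ->.
pose x g := odflt (c0 g) (greedy_stage p (rank g).+1 g).
have xE g : greedy_stage p (rank g).+1 g = Some (x g).
  by rewrite /x; case: (greedy_stage_rank p g) => c ->.
exists x; split=> [g h gh xgh|g c pg].
  (* At a stage where both vertices are coloured, properness applies. *)
  pose m := maxn (rank g).+1 (rank h).+1.
  have mg := greedy_stage_le _ _ m _ _ (leq_maxl _ _) (xE g).
  have mh := greedy_stage_le _ _ m _ _ (leq_maxr _ _) (xE h).
  by apply: (greedy_stage_proper _ m p_proper _ _ _ gh mg); rewrite mh xgh.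
by have := xE g; rewrite (greedy_stage_le _ 0 _ _ _ (leq0n _) pg) => -[].
Qed.

End Greedy.

(** * The Cayley graph of BS(1,N) *)

Section AffineAction.

Import GRing.Theory Num.Theory.
Local Open Scope ring_scope.

Variable N : nat.
Hypothesis hN : (2 <= N)%N.

Definition affine_letter (l : BSgen * bool) (t : rat) : rat :=
  match l with
  | (BSgen_a, false) => t + 1
  | (BSgen_a, true) => t - 1
  | (BSgen_b, false) => t * N%:R
  | (BSgen_b, true) => t / N%:R
  end.

Definition affine_word (w : word BSgen) (t : rat) : rat :=
  foldr affine_letter t w.

Let N_neq0 : N%:R != 0 :> rat.
Proof. by rewrite pnatr_eq0 -lt0n ltnW. Qed.

(** The affine maps satisfy the defining relation because
    N (t / N + 1) = t + N. *)
Lemma affine_word_eq u v :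
  word_eq (BSrel N) u v -> affine_word u =1 affine_word v.
Proof.
elim=> {u v} [u v [] t||u u' v v' _ IHu _ IHv t|//|u v _ IH t|u v w _ IH1 _ IH2 t].
- have aX k : affine_word (nseq k (BSgen_a, false)) t = t + k%:R.
    by elim: k => [|k IHk] /=; rewrite ?addr0 // IHk -addrA natr1.
  by rewrite aX /= mulrDl mul1r divfK.
- by case=> [] [] t /=; rewrite ?addrK ?subrK ?mulfK ?divfK.
- by rewrite /affine_word !foldr_cat -!/(affine_word _ _) IHv IHu.
- by rewrite IH.
- by rewrite IH1 IH2.
Qed.

Lemma BSa_neq1 : BSa N <> 1%g.
Proof.
by move=> /pres_classP/affine_word_eq/(_ 0)/eqP; rewrite /= add0r oner_eq0.
Qed.

Lemma BSb_neq1 : BSb N <> 1%g.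
Proof.
move=> /pres_classP/affine_word_eq/(_ 1)/eqP; rewrite /= mul1r.
by rewrite -[1]/(1%:R) eqr_nat gtn_eqF.
Qed.

End AffineAction.

Section Cayley.

Local Open Scope group_scope.

Variable N : nat.
Implicit Types g h s : BS N.

Definition BSsteps : seq (BS N) :=
  [:: BSa N; (BSa N)^-1; BSb N; (BSb N)^-1].

Definition BSnbr g : seq (BS N) := [seq g * s | s <- BSsteps].

Definition BSrank g : nat := choice.pickle (repr g : seq (BSgen * bool)).

Lemma BSrank_inj : injective BSrank.
Proof.
by move=> g h /(pcan_inj choice.pickleK) gh; rewrite -(pres_classK g) gh pres_classK.
Qed.

Lemma BSstepsV s : s \in BSsteps -> s^-1 \in BSsteps.
Proof.
by rewrite !inE => /or4P[] /eqP->; rewrite ?invgK eqxx ?orbT.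
Qed.

Lemma BSnbr_sym g h : h \in BSnbr g -> g \in BSnbr h.
Proof.
by case/mapP=> s /BSstepsV sV ->; apply/mapP; exists s^-1; rewrite ?mulgK.
Qed.

Lemma BSnbr_irr g : 2 <= N -> g \notin BSnbr g.
Proof.
move=> hN; apply/mapP => -[s s_step /eqP].
rewrite eq_sym -{2}[g]mulg1 (inj_eq (mulgI g)).
by move: s_step; rewrite !inE => /or4P[] /eqP->;
   rewrite ?invg_eq1 => /eqP; [apply: BSa_neq1|apply: BSa_neq1
     |apply: BSb_neq1|apply: BSb_neq1].
Qed.

Lemma BSnbr_gen g s : s \in [fset BSa N; BSb N] -> g * s \in BSnbr g.
Proof.
move=> s_gen; apply/mapP; exists s => //.
by move: s_gen; rewrite !inE => /orP[] ->; rewrite ?orbT.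
Qed.

(** Every edge joins some g to g * a or to g * b, in one direction or the other,
    so a symmetric property of edges need only be checked along the
    generators. *)
Lemma BSnbr_ind (P : BS N -> BS N -> Prop) :
  (forall g h, P g h -> P h g) ->
  (forall g s, s \in [fset BSa N; BSb N] -> P g (g * s)) ->
  forall g h, h \in BSnbr g -> P g h.
Proof.
move=> P_sym P_gen g h /mapP[s s_step ->].
have P_genV t : t \in [fset BSa N; BSb N] -> P g (g * t^-1).
  by move=> t_gen; apply: P_sym; rewrite -{2}[g](mulgVK t); apply: P_gen.
move: s_step; rewrite !inE => /or4P[] /eqP->;
  [apply: P_gen|apply: P_genV|apply: P_gen|apply: P_genV];
  by rewrite !inE eqxx ?orbT.
Qed.

Lemma BSball1_nbr (F : {fset BS N}) g h :
  g \in F -> h \in BSnbr g -> h \in fset_mul F (BSball1 N).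
Proof.
move=> gF /mapP[s s_step ->]; apply/imfset2P; exists g => //; exists s => //.
by move: s_step; rewrite !inE => /or4P[] ->; rewrite ?orbT.
Qed.

End Cayley.

(** * Gluing patterns *)

Section Gluing.

Local Open Scope group_scope.

Variables N n : nat.
Implicit Types p : {fmap BS N -> 'I_n}.

Lemma locally_admissible_proper p :
  locally_admissible p -> proper_partial (BS N) 'I_n (BSnbr N) (fnd p).
Proof.
move=> p_adm g h c gh; move: g h gh c.
apply: BSnbr_ind => [g h IH c pg ph|g s s_gen c pg pgs]; first exact: (IH c).
by apply: (p_adm g s) => //; rewrite -?fndSome ?pg ?pgs.
Qed.

Lemma globally_locally_admissible p :
  globally_admissible (coloring_shift N n) p -> locally_admissible p.
Proof.
move=> [x [x_col xp]] g s s_gen gp gsp; rewrite (xp _ gp) (xp _ gsp) => -[].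
exact: x_col.
Qed.

Definition glue p1 p2 (g : BS N) : option 'I_n :=
  if p1.[? g]%fmap is Some c then Some c else p2.[? g]%fmap.

(** No edge joins the two supports: the hypothesis excludes edges from the first
    to the second, and the ball is closed under inverses. *)
Lemma glue_proper p1 p2 :
  fset_mul (domf p1) (BSball1 N) `&` domf p2 = fset0 ->
  locally_admissible p1 -> locally_admissible p2 ->
  proper_partial (BS N) 'I_n (BSnbr N) (glue p1 p2).
Proof.
move=> far /locally_admissible_proper p1_proper /locally_admissible_proper p2_proper.
have apart g h c d : h \in BSnbr N g -> p1.[? g]%fmap = Some c ->
    p2.[? h]%fmap <> Some d.
  move=> gh p1g p2h; have gp1 : g \in domf p1 by rewrite -fndSome p1g.
  have /fsetP/(_ h) := far; rewrite !inE (BSball1_nbr _ _ _ _ gp1 gh) /=.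
  by rewrite -fndSome p2h.
move=> g h c gh; rewrite /glue.
case p1g: (p1.[? g]%fmap) => [d|]; case p1h: (p1.[? h]%fmap) => [e|].
- by move=> dc; rewrite -p1h; apply: p1_proper gh _; rewrite p1g.
- by move=> _; apply: apart gh p1g.
- by move=> p2g _; apply: (apart h g e c) p2g => //; apply: BSnbr_sym.
- exact: p2_proper.
Qed.

Lemma glue_coloring p1 p2 : 2 <= N -> 5 <= n ->
  fset_mul (domf p1) (BSball1 N) `&` domf p2 = fset0 ->
  locally_admissible p1 -> locally_admissible p2 ->
  exists x : BS N -> 'I_n,
    [/\ coloring_shift N n x, restricts_to x p1 & restricts_to x p2].
Proof.
move=> hN hn far p1_adm p2_adm.
have nbr_small g : size (BSnbr N g) < #|'I_n| by rewrite card_ord.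
have [x [x_col x_glue]] := greedy_extension _ _ _ _ (BSrank_inj N)
  (BSnbr_sym N) (fun g => BSnbr_irr N g hN) nbr_small _
  (glue_proper _ _ far p1_adm p2_adm).
exists x; split=> [g s s_gen|g gp1|g gp2].
- exact/x_col/BSnbr_gen.
- move: gp1; rewrite -fndSome; case p1g: (p1.[? g]%fmap) => [c|] // _.
  by rewrite (x_glue g c) // /glue p1g.
- have p1g : p1.[? g]%fmap = None.
    (* The ball contains 1, so the supports themselves are disjoint. *)
    apply: not_fnd; apply/negP => gp1.
    have /fsetP/(_ g) := far; rewrite !inE gp2 andbT => /negP; apply.
    by apply/imfset2P; exists g => //; exists 1; rewrite ?mulg1 // !inE eqxx.
  move: gp2; rewrite -fndSome; case p2g: (p2.[? g]%fmap) => [c|] // _.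
  by rewrite (x_glue g c) // /glue p1g.
Qed.

End Gluing.

Theorem theorem4p5 (N n : nat) (hN : (2 <= N)%N) (hn : (5 <= n)%N) :
  (forall F1 F2 : {fset BS N},
     fset_mul F1 (BSball1 N) `&` F2 = fset0 ->
     forall p1 p2 : {fmap BS N -> 'I_n},
       domf p1 = F1 -> domf p2 = F2 ->
       locally_admissible p1 -> locally_admissible p2 ->
       exists x : BS N -> 'I_n,
         [/\ coloring_shift N n x, restricts_to x p1 & restricts_to x p2])
  /\ strongly_irreducible (coloring_shift N n).
Proof.
split=> [F1 F2 far p1 p2 dp1 dp2|].
  by rewrite -dp1 -dp2 in far; exact: glue_coloring.
exists (BSball1 N) => p q /globally_locally_admissible p_adm.
move=> /globally_locally_admissible q_adm; rewrite fsetIC => far.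
have [x [x_col xq xp]] := glue_coloring N n q p hN hn far q_adm p_adm.
by exists x; split; split.
Qed.
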